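(* There exists a nuciferous graph that is not isomorphic to the complete graph $K_2$. That is, there exists a finite simple graph $G$, not isomorphic to $K_2$, whose $0$-$1$ adjacency matrix $A$ is non-singular over $\mathbb{R}$ and such that all the diagonal entries of $A^{-1}$ are zero and all the off-diagonal entries of $A^{-1}$ are non-zero.
   Context: A simple graph is an undirected graph without loops or multiple edges. The $0$-$1$ adjacency matrix of a finite simple graph $G$ with vertices $v_1,\dots,v_n$ is the real symmetric $n\times n$ matrix $A$ with $A_{ij}=1$ if $v_i$ and $v_j$ are adjacent and $A_{ij}=0$ otherwise (in particular, $A_{ii}=0$). A graph $G$ is called nuciferous if its adjacency matrix $A$ is non-singular, all the diagonal entries of $A^{-1}$ are zero, and all the off-diagonal entries of $A^{-1}$ are non-zero. *)

(* Defs.v *)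
From mathcomp Require Import all_boot all_order all_algebra.
From mathcomp Require Import reals.

Set Implicit Arguments.
Unset Strict Implicit.
Unset Printing Implicit Defensive.

Import GRing.Theory.
Local Open Scope ring_scope.

Record sgraph := SGraph {
  vertex :> finType;
  adj : rel vertex;
  adj_sym : symmetric adj;
  adj_irr : irreflexive adj
}.

Definition sg_isomorphic (G H : sgraph) : Prop :=
  exists2 f : G -> H, bijective f & forall x y : G, adj (f x) (f y) = adj x y.

Section Complete.
Variable n : nat.

Definition complete_adj : rel 'I_n := fun i j => i != j.

Fact complete_adj_sym : symmetric complete_adj.
Proof. by move=> i j; rewrite /complete_adj eq_sym. Qed.

Fact complete_adj_irr : irreflexive complete_adj.
Proof. by move=> i; rewrite /complete_adj eqxx. Qed.

Definition complete_graph : sgraph :=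
  SGraph complete_adj_sym complete_adj_irr.

End Complete.

(* The vertices v_1, ..., v_n are listed in the order given by [enum_val]. *)
Definition adjacency_mx (R : realType) (G : sgraph) : 'M[R]_#|G| :=
  \matrix_(i, j) (adj (enum_val i) (enum_val j))%:R.

(* The graph without vertices satisfies this definition vacuously, since the
   0 x 0 matrix is invertible: graphs must be required to be nonempty where
   that matters. *)
Definition nuciferous (R : realType) (G : sgraph) : Prop :=
  let A := adjacency_mx R G in
  [/\ A \in unitmx,
      forall i, invmx A i i = 0
    & forall i j, i != j -> invmx A i j != 0].

(* Main.v *)
Require Import Defs.
From mathcomp Require Import all_boot all_order all_algebra.
From mathcomp Require Import reals.

(** The graph is a Cayley graph of the cyclic group of order 30.

    The adjacency matrix of a Cayley graph of a finite abelian group [V] acts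
    on functions on [V] as convolution by the indicator function of the
    connection set, so inverting it means inverting that indicator in the
    group algebra [R[V]].  If [b] is the inverse, all the diagonal entries of
    the inverse matrix are [b 0] and the off-diagonal ones are the [b d] with
    [d != 0]; see [cayley_nuciferous].  It remains to find a group and a
    symmetric connection set whose inverse [b] vanishes at [0] and nowhere
    else.

    By the Chinese remainder theorem the group is Z/2 x Z/3 x Z/5.  Write [t]
    for the generator of Z/2, [J] for the sum of the elements of Z/3, [x] for
    a generator of Z/5, [c1 = x + x^-1] and [c2 = x^2 + x^-2].  The indicator
    of the connection set is

      a = (J - 1) c1 + t J + (1 + t) c2.

    At a character with [t = 1] or [-1], [J = 3] or [0] it takes the values

      2 c1 + 2 c2 + 3   (t =  1, J = 3),     2 c2 - c1   (t =  1, J = 0),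
      2 c1 - 3          (t = -1, J = 3),     - c1        (t = -1, J = 0),

    where [c1 = c2 = 2] at the trivial character of Z/5, and [c1] and [c2] are
    the two roots of [c^2 + c - 1] at the other four, in each order twice.
    None of these values is zero, so [a] is invertible, and [30 (b 0)] is the
    sum of their inverses over the 30 characters.  The case [J = 0] arises
    from two characters of Z/3, so this sum is

      (1/11 + 4) + 2 (1/2 + 2/11) + (1 - 16/11) + 2 (- 1/2 - 2) = 0.

    The other values of [b] come from the inverse Fourier transform; they are
    the nonzero integers tabulated in [weight], divided by 22.  Once they are
    known, [a * b = 1] is an identity between integers at each of the thirty
    residues, which [connection_conv_weight] establishes by evaluation. *)

Set Implicit Arguments.
Unset Strict Implicit.
Unset Printing Implicit Defensive.

Import GRing.Theory Num.Theory.
Local Open Scope ring_scope.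

(** * Cayley graphs of abelian groups and convolution inverses *)

Section Cayley.

Variables (V : finZmodType) (S : pred V).
Hypotheses (S_opp : forall x, S (- x) = S x) (S_0 : S 0 = false).

Definition cayley_adj : rel V := fun x y => S (y - x).

Fact cayley_adj_sym : symmetric cayley_adj.
Proof. by move=> x y; rewrite /cayley_adj -opprB S_opp. Qed.

Fact cayley_adj_irr : irreflexive cayley_adj.
Proof. by move=> x; rewrite /cayley_adj subrr. Qed.

Definition cayley_graph : sgraph := SGraph cayley_adj_sym cayley_adj_irr.

Variables (R : realType) (b : V -> R).
Hypothesis conv_b : forall d, \sum_k (S k)%:R * b (d - k) = (d == 0)%:R.

Let B : 'M[R]_#|cayley_graph| :=
  \matrix_(i, j) b (enum_val j - enum_val i).

(** With [k] replaced by [k + x], the sum of [S (k - x) * b (y - k)] over [k]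
    is the convolution of [S] and [b] at [y - x]. *)
Lemma cayley_mulmx : adjacency_mx R cayley_graph *m B = 1%:M.
Proof.
apply/matrixP=> i j; rewrite !mxE.
under eq_bigr => k _ do rewrite !mxE /= /cayley_adj.
pose F (z : V) : R := (S (z - enum_val i))%:R * b (enum_val j - z).
rewrite -(big_enum_val (A := V) F) /F /=.
rewrite (reindex_inj (addIr (enum_val i))) /=.
under eq_bigr => k _ do rewrite addrK opprD [- k - _]addrC addrA.
by rewrite conv_b subr_eq0 (inj_eq enum_val_inj) eq_sym.
Qed.

Lemma cayley_nuciferous :
  b 0 = 0 -> (forall d, d != 0 -> b d != 0) -> nuciferous R cayley_graph.
Proof.
move=> b0 bN0.
have [uA _] := mulmx1_unit cayley_mulmx.
have invA : invmx (adjacency_mx R cayley_graph) = B.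
  by rewrite -[LHS]mulmx1 -cayley_mulmx mulKmx.
split=> // [i | i j neq_ij]; rewrite invA mxE ?subrr //.
by rewrite bN0 // subr_eq0 (inj_eq enum_val_inj) eq_sym.
Qed.

End Cayley.

(** * A connection set in the cyclic group of order 30 *)

(** In Z/2 x Z/3 x Z/5, the residues 4, 14, 16, 26 are the terms of
    [(J - 1) c1], the residues 5, 15, 25 those of [t J], and 3, 12, 18, 27
    those of [(1 + t) c2]. *)
Definition connection (m : nat) : bool :=
  m \in [:: 3; 4; 5; 12; 14; 15; 16; 18; 25; 26; 27]%N.

(** Given on the residues 0, ..., 15 and extended by the symmetry
    [d |-> 30 - d]. *)
Definition weight (m : nat) : int :=
  nth 0 [:: 0; -3; -2; -4; 2; 1; -4; -1; -2; 2; 4; -3; 6; -1; 2; 8]%Z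
        (minn m (30 - m)).

(** The convolution of [connection] and [weight] in terms of representatives
    in [nat] and of a fold over a list, because big operators are opaque and
    would block evaluation. *)
Definition conv_table (d : nat) : int :=
  foldr +%R 0
    [seq (connection k)%:R * weight ((d + (30 - k) %% 30) %% 30)
    | k <- iota 0 30].

Lemma all_residues (p : pred nat) :
  all p (iota 0 30) -> forall x : 'Z_30, p x.
Proof. by move=> /allP p_all x; rewrite p_all // mem_iota ltn_ord. Qed.

Lemma connection_opp (x : 'Z_30) : connection (- x)%R = connection x.
Proof.
apply/eqP; move: x.
apply: (all_residues (p := fun m => connection ((30 - m) %% 30) == connection m)).
by vm_compute.
Qed.

Lemma weight_neq0 (x : 'Z_30) : x != 0 -> weight x != 0.
Proof.
apply/implyP; move: x.
apply: (all_residues (p := fun m => (m != 0%N) ==> (weight m != 0))).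
by vm_compute.
Qed.

(** In the group algebra, the connection set times [weight] is 22. *)
Lemma connection_conv_weight (d : 'Z_30) :
  \sum_(k : 'Z_30) (connection k)%:R * weight (d - k)%R = 22 * (d == 0)%:R.
Proof.
transitivity (conv_table d).
  rewrite /conv_table foldrE big_map.
  by rewrite -[iota 0 30]/(index_iota 0 30) big_mkord.
apply/eqP; move: d.
apply: (all_residues (p := fun m => conv_table m == 22 * (m == 0%N)%:R)).
by vm_compute.
Qed.

Theorem mainTheorem1 (R : realType) :
  exists G : sgraph,
    [/\ (0 < #|G|)%N, nuciferous R G & ~ sg_isomorphic G (complete_graph 2)].
Proof.
have card_G : #|cayley_graph connection_opp erefl| = 30 by rewrite card_ord.
exists (cayley_graph connection_opp erefl); split.
- by rewrite card_G.
- have R22 : (22 : R) != 0 by rewrite pnatr_eq0.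
  apply: (@cayley_nuciferous _ _ _ _ R (fun d : 'Z_30 => (weight d)%:~R / 22)).
  + move=> d; apply: (mulIf R22).
    rewrite mulr_suml.
    under eq_bigr => k _ do rewrite -mulrA divfK // -[_%:R]mulrz_nat -intrM.
    rewrite -rmorph_sum /= connection_conv_weight intrM mulrC.
    by case: (d == 0).
  + by rewrite mul0r.
  + move=> d d_neq0.
    by rewrite mulf_neq0 ?invr_eq0 // intr_eq0 weight_neq0.
- case=> f /bij_eq_card; rewrite card_G /= card_ord; discriminate.
Qed.
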